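(* Let $p\in\{2,3\}$, $\nu\in[0,1]$, $q=p+\nu$ with $q>2$, and suppose that $f$ satisfies the $(p,\nu)$-Hölder condition on $\mathcal X$ with constant $L_{p,\nu}>0$. Let $\mu,L>0$ be constants such that $\mu I\preceq\nabla^2 f(x)\preceq LI$ for all $x\in\mathcal X$ (such constants exist under these assumptions). Let $\rho\in(0,1)$ and let $\omega$ satisfy $$0<\omega<\frac{c_p\mu}{L}\rho^2\bigl(1-\rho^{q/(q-1)}\bigr).$$ Let $\chi$ be any number in the (nonempty) interval $$\frac{\omega}{B_q(1-\rho^{q/(q-1)})}<\chi<\frac{\rho^{(q-2)/(q-1)}}{B_q}\left(\frac{c_p\mu}{L}-\frac{\omega}{\rho^2}\right)$$ and let $$c_\chi=\min\left\{\frac{c_p\mu}{B_qL}-\frac{\omega}{B_q\rho^2}-\chi\rho^{-\frac{q-2}{q-1}},\ \frac{\chi(1-\rho^{\frac{q}{q-1}})-\omega/B_q}{\rho^2}\right\}>0 .$$ Let $\{x_k\}$ be generated by the damped Newton Frank–Wolfe method with residual backtracking (with either inner procedure FW or AFW), and let $\Phi(x_k)=f(x_k)-f(x^\star)+\chi\Delta_k^{q/(q-1)}$. Then for all $k\ge0$ (for which $x_k$ is generated), $$f(x_k)-f(x^\star)\le\Phi(x_k)\le\left(1+\frac{c_\chi\,\rho^{(q-2)/(q-1)}}{\chi+\left(\frac{L}{2\mu}+\omega\rho^{-2}\right)\left(\Phi(x_0)/\chi\right)^{(q-2)/q}}\right)^{-k}\Phi(x_0).$$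
   Context: Setting. $\mathcal X\subset\mathbb R^n$ is a nonempty compact convex set; $f:\mathbb R^n\to\mathbb R$ is convex and twice differentiable with $\nabla^2 f(x)$ positive definite for all $x\in\mathcal X$; $x^\star$ is a minimizer of $f$ over $\mathcal X$. $\|\cdot\|$ is the Euclidean norm; $\|y\|_x=\langle\nabla^2f(x)y,y\rangle^{1/2}$, $\|h\|_x^*=\langle h,\nabla^2f(x)^{-1}h\rangle^{1/2}$; for positive definite $H$, $\|y\|_H=\langle Hy,y\rangle^{1/2}$. $(p,\nu)$-Hölder condition with constant $L_{p,\nu}$. For $p=2$: for all $x,y\in\mathcal X$, $\sup_{z\ne0}\|(\nabla^2f(x)-\nabla^2f(y))z\|_x^*/\|z\|_x\le L_{2,\nu}\|x-y\|_x^\nu$. For $p=3$: $f$ is three times differentiable; for all $x,y\in\mathcal X$, $\sup_{z_1,z_2,z_3\ne0}\frac{|(\nabla^3f(x)-\nabla^3f(y))[z_1,z_2,z_3]|}{\|z_1\|_x\|z_2\|_x\|z_3\|_x}\le L_{3,\nu}\|x-y\|_x^\nu$; and $\Gamma_{3,\mathcal X}=\sup_{x\in\mathcal X}\sup_{z_1,z_2,z_3\ne0}\frac{|\nabla^3f(x)[z_1,z_2,z_3]|}{\|z_1\|_x\|z_2\|_x\|z_3\|_x}$ is finite with $\Gamma_{3,\mathcal X}\le2(L_{3,\nu}/(1+\nu))^{1/(1+\nu)}$. Constants. $c_2=1/2$, $c_3=1/4$; $\kappa_\omega=\frac{1+\sqrt{1+4\omega(1+\rho^{-2})}}{2}$;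 $B_q=(9L_{p,\nu})^{1/(q-1)}\kappa_\omega^{(q-2)/(q-1)}$. Inner procedure FW$(h,H,u,\eta)$. Set $u_0=u$. For $t=0,1,\dots$: take $v_t\in\arg\min_{v\in\mathcal X}\langle h+H(u_t-u),v\rangle$; if $\langle h+H(u_t-u),u_t-v_t\rangle\le\eta$ return $u_t$; otherwise $\gamma_t=\min\{1,\langle h+H(u_t-u),u_t-v_t\rangle/\|v_t-u_t\|_H^2\}$ and $u_{t+1}=(1-\gamma_t)u_t+\gamma_tv_t$. Inner procedure AFW$(h,H,u,\eta,\mathcal S,\lambda)$ (away-step FW). Here $\mathcal S$ is a finite set of extreme points of $\mathcal X$ and $\lambda$ positive weights on $\mathcal S$ summing to 1 with $u=\sum_{v\in\mathcal S}\lambda_vv$; linear minimization over $\mathcal X$ is assumed to return extreme points. Set $u_0=u,\mathcal S_0=\mathcal S,\lambda_0=\lambda$. For $t=0,1,\dots$, with $G=h+H(u_t-u)$: take $v_t^{FW}\in\arg\min_{v\in\mathcal X}\langle G,v\rangle$; if $\langle G,u_t-v_t^{FW}\rangle\le\eta$ return $(u_t,\mathcal S_t,\lambda_t)$; take $v_t^A\in\arg\max_{v\in\mathcal S_t}\langle G,v\rangle$. If $\langle G,u_t-v_t^{FW}\rangle\ge\langle G,v_t^A-u_t\rangle$ (FW step) put $d_t=u_t-v_t^{FW}$, $\gamma_{t,\max}=1$; otherwise (away step) put $d_t=v_t^A-u_t$, $\gamma_{t,\max}=\lambda_{v_t^A,t}/(1-\lambda_{v_t^A,t})$. Set $\gamma_t=\min\{\gamma_{t,\max},\langle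 G,d_t\rangle/\|d_t\|_H^2\}$, $u_{t+1}=u_t-\gamma_td_t$. Weights: in an FW step multiply all weights by $1-\gamma_t$ and add $\gamma_t$ to the weight of $v_t^{FW}$ (inserting it in the active set if needed; if $\gamma_t=1$ the active set becomes $\{v_t^{FW}\}$); in an away step multiply all weights by $1+\gamma_t$, subtract $\gamma_t$ from that of $v_t^A$, and remove $v_t^A$ from the active set if its weight becomes 0. Damped Newton Frank–Wolfe method with residual backtracking. Parameters $\rho\in(0,1)$, $\omega>0$, $\bar\theta_0>0$, $\tau>1$; $x_0\in\mathcal X$ (for AFW, $x_0$ is an extreme point returned by linear minimization over $\mathcal X$, with initial active set $\{x_0\}$ and weight 1). Initialize $s_{-1}=0$, $\Delta_{-1}=0$. At outer iteration $k$: if the FW gap $g_k=\max_{v\in\mathcal X}\langle\nabla f(x_k),x_k-v\rangle$ is $0$, terminate. Otherwise set $r_k=\nabla f(x_k)+s_{k-1}$, $\Delta_k=\max\{\|r_k\|_{x_k}^*,\rho\Delta_{k-1}\}$ (also used to define $\Delta_k$ at the final iterate), $\eta_k=\frac{\omega\Delta_k^2}{1+B_q\Delta_k^{(q-2)/(q-1)}}$. For $j=0,1,2,\dots$: $\theta_{k,j}=\min\{\tau^j\bar\theta_k,B_q\Delta_k^{(q-2)/(q-1)}\}$, $\alpha_{k,j}=1/(1+\theta_{k,j})$; let $x_{k,j}$ be the point returned by the inner procedure with $h=\nabla f(x_k)$, $H=\alpha_{k,j}^{-1}\nabla^2f(x_k)$, $u=x_k$, $\eta=\eta_k$ (for AFW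 also the current active set and weights of $x_k$); $s_{k,j}=-\nabla f(x_k)-\alpha_{k,j}^{-1}\nabla^2f(x_k)(x_{k,j}-x_k)$, $w_{k,j}=\nabla f(x_k)+s_{k,j}$, $r_{k+1,j}=\nabla f(x_{k,j})+s_{k,j}$. Accept the first $j$ with $\langle r_{k+1,j},\nabla^2f(x_k)^{-1}w_{k,j}\rangle\ge\frac{c_p}{\alpha_{k,j}\theta_{k,j}}\|r_{k+1,j}\|_{x_k}^{*2}$, and set $\theta_k=\theta_{k,j}$, $\alpha_k=\alpha_{k,j}$, $x_{k+1}=x_{k,j}$, $s_k=s_{k,j}$, $\bar\theta_{k+1}=\theta_k/\tau$ (for AFW, carry over the active set and weights of the accepted trial). *)

(* Defs.v *)
From HB Require Import structures.
From mathcomp Require Import all_boot all_order all_algebra finmap.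
From mathcomp Require Import all_classical all_reals all_analysis.
Import Order.TTheory GRing.Theory Num.Theory.
Import numFieldNormedType.Exports.

Set Implicit Arguments.
Unset Strict Implicit.
Unset Printing Implicit Defensive.

Local Open Scope classical_set_scope.
Local Open Scope ring_scope.

Section Euclidean.
Context {R : realType} {n : nat}.
Implicit Types (A H : 'M[R]_n) (x y z h : 'cV[R]_n) (X : set 'cV[R]_n).

Definition dotp x y : R := (x^T *m y) 0 0.

Definition lnorm H y : R := Num.sqrt (dotp (H *m y) y).

Definition dnorm H h : R := Num.sqrt (dotp h (invmx H *m h)).

Definition posdef H : Prop :=
  H^T = H /\ forall y, y != 0 -> 0 < dotp (H *m y) y.

Definition possemidef H : Prop :=
  H^T = H /\ forall y, 0 <= dotp (H *m y) y.

Definition loewner_le A H : Prop := possemidef (H - A).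

Definition extreme_point X x : Prop :=
  X x /\ forall y z (t : R), X y -> X z -> 0 < t < 1 ->
    x = t *: y + (1 - t) *: z -> y = x /\ z = x.

Definition is_argmin X (phi : 'cV[R]_n -> R) x : Prop :=
  X x /\ forall y, X y -> phi x <= phi y.

Definition is_argmax X (phi : 'cV[R]_n -> R) x : Prop :=
  X x /\ forall y, X y -> phi y <= phi x.

End Euclidean.

(* [differentiable] is Frechet differentiability for the sup norm that MathComp
   puts on matrices; in finite dimension this is the Euclidean notion. *)
Section Derivatives.
Context {R : realType} {n : nat}.
Implicit Types (f : 'cV[R]_n -> R) (x z : 'cV[R]_n) (X : set 'cV[R]_n).

Definition grad f x : 'cV[R]_n := \col_i 'D_(delta_mx i 0) f x.

Definition hess f x : 'M[R]_n :=
  \matrix_(i, j) ('D_(delta_mx j 0) (grad f) x) i 0.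

Definition d3 f x z1 z2 z3 : R := dotp ('D_z1 (hess f) x *m z2) z3.

Definition twice_differentiable f : Prop :=
  (forall x, differentiable f x) /\ (forall x, differentiable (grad f) x).

Definition thrice_differentiable f : Prop :=
  twice_differentiable f /\ forall x, differentiable (hess f) x.

Definition matrix_gnorm (H A : 'M[R]_n) : \bar R :=
  ereal_sup [set (dnorm H (A *m z) / lnorm H z)%:E | z in [set z | z != 0]].

Definition trilinear_gnorm (H : 'M[R]_n)
    (T : 'cV[R]_n -> 'cV[R]_n -> 'cV[R]_n -> R) : \bar R :=
  ereal_sup [set e | exists z1 z2 z3, [/\ z1 != 0, z2 != 0, z3 != 0 &
    e = (`|T z1 z2 z3| / (lnorm H z1 * lnorm H z2 * lnorm H z3))%:E]].

Definition Gamma3 f X : \bar R :=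
  ereal_sup [set trilinear_gnorm (hess f x) (d3 f x) | x in X].

Definition holder2 f X (nu M : R) : Prop :=
  forall x y, X x -> X y ->
    (matrix_gnorm (hess f x) (hess f x - hess f y)%R
     <= (M * lnorm (hess f x) (x - y) `^ nu)%R%:E)%E.

(* Finiteness of Gamma3 is [< +oo]: it is a supremum of nonnegative numbers,
   except when n = 0, where the supremum is over the empty set. *)
Definition holder3 f X (nu M : R) : Prop :=
  [/\ thrice_differentiable f,
      (forall x y, X x -> X y ->
        (trilinear_gnorm (hess f x)
           (fun z1 z2 z3 => (d3 f x z1 z2 z3 - d3 f y z1 z2 z3)%R)
         <= (M * lnorm (hess f x) (x - y) `^ nu)%R%:E)%E),
      (Gamma3 f X < +oo)%E &
      (Gamma3 f X <= (2 * (M / (1 + nu)) `^ (1 + nu)^-1)%R%:E)%E].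

Definition holder_condition (p : nat) f X (nu M : R) : Prop :=
  match p with
  | 2 => holder2 f X nu M
  | 3 => holder3 f X nu M
  | _ => False
  end.

Definition fw_gap f X x : R := sup [set dotp (grad f x) (x - v) | v in X].

Definition hessian_bounds f X (mu L : R) : Prop :=
  forall x, X x ->
    loewner_le mu%:M (hess f x) /\ loewner_le (hess f x) L%:M.

End Derivatives.

Section Constants.
Context {R : realType}.

Definition cst_c (p : nat) : R := if p == 2%N then 2^-1 else 4^-1.

Definition cst_kappa (rho omega : R) : R :=
  (1 + Num.sqrt (1 + 4 * omega * (1 + rho ^- 2))) / 2.

Definition cst_B (q M rho omega : R) : R :=
  (9 * M) `^ (q - 1)^-1 * cst_kappa rho omega `^ ((q - 2) / (q - 1)).

End Constants.

Inductive variant := FW | AFW.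

(* Weights are functions on the whole space; every run keeps them equal to 0
   outside the active set. *)
Record active (R : realType) (n : nat) := Active {
  act_set : {fset 'cV[R]_n};
  act_wgt : 'cV[R]_n -> R
}.

Section InnerProcedures.
Context {R : realType} {n : nat}.
Variables (X : set 'cV[R]_n) (h : 'cV[R]_n) (H : 'M[R]_n)
  (u : 'cV[R]_n) (eta : R).
Implicit Types (x v y : 'cV[R]_n) (a b : active R n).

Definition model_grad x : 'cV[R]_n := h + H *m (x - u).

Definition fw_stepsize x v : R :=
  Num.min 1 (dotp (model_grad x) (x - v) / lnorm H (v - x) ^+ 2).

(* [fw_run x y]: continuing FW from the inner iterate x, the point y is
   returned. *)
Inductive fw_run : 'cV[R]_n -> 'cV[R]_n -> Prop :=
| fw_stop x v :
    is_argmin X (dotp (model_grad x)) v ->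
    dotp (model_grad x) (x - v) <= eta ->
    fw_run x x
| fw_move x v y :
    is_argmin X (dotp (model_grad x)) v ->
    eta < dotp (model_grad x) (x - v) ->
    fw_run ((1 - fw_stepsize x v) *: x + fw_stepsize x v *: v) y ->
    fw_run x y.

Definition afw_stepsize (gmax : R) x d : R :=
  Num.min gmax (dotp (model_grad x) d / lnorm H d ^+ 2).

Definition fw_active (g : R) v a : active R n :=
  Active (if (g == 1)%R then [fset v] else v |` act_set a)%fset
    (fun w => (1 - g) * act_wgt a w + (if w == v then g else 0)).

Definition away_active (g : R) v a : active R n :=
  let wgt w := (1 + g) * act_wgt a w - (if w == v then g else 0) in
  Active (if (wgt v == 0)%R then act_set a `\ v else act_set a)%fset wgt.

Inductive afw_run :
  'cV[R]_n -> active R n -> 'cV[R]_n -> active R n -> Prop :=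
| afw_stop x a v :
    is_argmin X (dotp (model_grad x)) v -> extreme_point X v ->
    dotp (model_grad x) (x - v) <= eta ->
    afw_run x a x a
| afw_fw_move x a v vA y b :
    is_argmin X (dotp (model_grad x)) v -> extreme_point X v ->
    eta < dotp (model_grad x) (x - v) ->
    is_argmax [set` act_set a] (dotp (model_grad x)) vA ->
    dotp (model_grad x) (vA - x) <= dotp (model_grad x) (x - v) ->
    (let g := afw_stepsize 1 x (x - v) in
     afw_run (x - g *: (x - v)) (fw_active g v a) y b) ->
    afw_run x a y b
| afw_away_move x a v vA y b :
    is_argmin X (dotp (model_grad x)) v -> extreme_point X v ->
    eta < dotp (model_grad x) (x - v) ->
    is_argmax [set` act_set a] (dotp (model_grad x)) vA ->
    dotp (model_grad x) (x - v) < dotp (model_grad x) (vA - x) ->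
    (let gmax := act_wgt a vA / (1 - act_wgt a vA) in
     let g := afw_stepsize gmax x (vA - x) in
     afw_run (x - g *: (vA - x)) (away_active g vA a) y b) ->
    afw_run x a y b.

(* FW ignores the active set and passes it on unchanged. *)
Definition inner_returns (var : variant) a y b : Prop :=
  match var with
  | FW => fw_run u y /\ b = a
  | AFW => afw_run u a y b
  end.

End InnerProcedures.

(* State at the start of outer iteration k: x_k with its active set, s_{k-1},
   Delta_{k-1}, and the first trial value \bar\theta_k. *)
Record state (R : realType) (n : nat) := State {
  st_x : 'cV[R]_n;
  st_act : active R n;
  st_s : 'cV[R]_n;
  st_Delta : R;
  st_theta : R
}.

Section OuterMethod.
Context {R : realType} {n : nat}.
Variables (var : variant) (X : set 'cV[R]_n) (f : 'cV[R]_n -> R).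
Variables (q c B rho omega tau theta0 : R).
Implicit Types (st : state R n) (x y s : 'cV[R]_n).

(* Delta_k, as opposed to the stored Delta_{k-1}. *)
Definition Delta st : R :=
  Num.max (dnorm (hess f (st_x st)) (grad f (st_x st) + st_s st))
          (rho * st_Delta st).

Definition theta_max st : R := B * Delta st `^ ((q - 2) / (q - 1)).

Definition tolerance st : R := omega * Delta st ^+ 2 / (1 + theta_max st).

Definition trial_theta st (j : nat) : R :=
  Num.min (tau ^+ j * st_theta st) (theta_max st).

Definition trial_alpha st j : R := (1 + trial_theta st j)^-1.

Definition trial_s st j y : 'cV[R]_n :=
  - grad f (st_x st) -
    (trial_alpha st j)^-1 *: (hess f (st_x st) *m (y - st_x st)).

Definition trial_accepted st j y : bool :=
  let w := grad f (st_x st) + trial_s st j y in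
  let r := grad f y + trial_s st j y in
  dotp r (invmx (hess f (st_x st)) *m w) >=
    c / (trial_alpha st j * trial_theta st j) * dnorm (hess f (st_x st)) r ^+ 2.

Definition outer_step st st' : Prop :=
  fw_gap f X (st_x st) != 0 /\
  exists (J : nat) (y : nat -> 'cV[R]_n) (a : nat -> active R n),
    [/\ (forall j, (j <= J)%N ->
          inner_returns X (grad f (st_x st))
            ((trial_alpha st j)^-1 *: hess f (st_x st)) (st_x st)
            (tolerance st) var (st_act st) (y j) (a j)),
        (forall j, (j < J)%N -> ~~ trial_accepted st j (y j)),
        trial_accepted st J (y J) &
        st' = State (y J) (a J) (trial_s st J (y J)) (Delta st)
                (trial_theta st J / tau)].

Definition initial_point x : Prop :=
  match var with
  | FW => X x
  | AFW => extreme_point X x /\ exists g, is_argmin X (dotp g) x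
  end.

Definition initial_state x : state R n :=
  State x (Active [fset x]%fset (fun w => (w == x)%:R)) 0 0 theta0.

(* [st] lists the states of a run in which x_0, ..., x_k are generated. *)
Definition generated (st : nat -> state R n) (k : nat) : Prop :=
  (exists2 x, initial_point x & st 0%N = initial_state x) /\
  forall i, (i < k)%N -> outer_step (st i) (st i.+1).

End OuterMethod.

(* Main.v *)
(** With [a = (q - 2) / (q - 1)] and [b = q / (q - 1)], so that [a + b = 2]:
    acceptance of a trial says [<r+, x - x+> >= (c / theta) |r+|*_x^2], and the
    inner stopping test says [<s+, v - x+> <= eta] on [X]. By convexity, and
    comparing the dual norms at [x] and [x+] through [mu] and [L], these give
    [f x - f x+ >= ((c mu / L) |r+|*_{x+}^2 - omega D^2) / (B D^a)] where [D] is
    the current Delta. With [E] the next Delta, the potential therefore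
    decreases by at least [c_chi E^2 / D^a]. Strong convexity bounds
    [f x+ - f xstar] by [(L / (2 mu) + omega / rho^2) E^2], so this decrease is
    a fixed fraction of the new potential. *)

Require Import Defs.
From mathcomp Require Import all_boot all_order all_algebra.
From mathcomp Require Import finmap ring lra.
From mathcomp Require Import all_classical all_reals all_analysis.
Import Order.TTheory GRing.Theory Num.Theory.
Import numFieldNormedType.Exports.
Local Open Scope classical_set_scope.
Local Open Scope ring_scope.

(** * Inner product, quadratic forms and dual norms *)

Section QuadraticForms.
Context {R : realType} {n : nat}.
Implicit Types (A H : 'M[R]_n) (x y z h g : 'cV[R]_n).

Lemma dotpE x y : dotp x y = \sum_i x i 0 * y i 0.
Proof. by rewrite /dotp !mxE; apply: eq_bigr => i _; rewrite !mxE. Qed.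

Lemma dotpC x y : dotp x y = dotp y x.
Proof. by rewrite !dotpE; apply: eq_bigr => i _; rewrite mulrC. Qed.

Lemma dotpDl x y z : dotp (x + y) z = dotp x z + dotp y z.
Proof. by rewrite !dotpE -big_split; apply: eq_bigr => i _; rewrite !mxE mulrDl. Qed.

Lemma dotpZl a x z : dotp (a *: x) z = a * dotp x z.
Proof. by rewrite !dotpE big_distrr; apply: eq_bigr => i _; rewrite !mxE -mulrA. Qed.

Lemma dotpNl x z : dotp (- x) z = - dotp x z.
Proof. by rewrite -scaleN1r dotpZl mulN1r. Qed.

Lemma dotpDr x y z : dotp z (x + y) = dotp z x + dotp z y.
Proof. by rewrite dotpC dotpDl !(dotpC z). Qed.

Lemma dotpZr a x z : dotp z (a *: x) = a * dotp z x.
Proof. by rewrite dotpC dotpZl (dotpC z). Qed.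

Lemma dotpNr x z : dotp z (- x) = - dotp z x.
Proof. by rewrite dotpC dotpNl (dotpC z). Qed.

Definition dotp_lin := (dotpDl, dotpDr, dotpZl, dotpZr, dotpNl, dotpNr).

Lemma dotp0l x : dotp 0 x = 0.
Proof. by rewrite -(scale0r 0) dotpZl mul0r. Qed.

Lemma dotp_ge0 x : 0 <= dotp x x.
Proof. by rewrite dotpE sumr_ge0// => i _; rewrite -expr2 sqr_ge0. Qed.

Lemma dotp_mulmxl A x y : dotp (A *m x) y = dotp x (A^T *m y).
Proof. by rewrite /dotp trmx_mul mulmxA. Qed.

Lemma dotp_sym {H} (Hs : H^T = H) x y : dotp (H *m x) y = dotp (H *m y) x.
Proof. by rewrite dotp_mulmxl Hs dotpC. Qed.

Lemma posdef_ge0 {H} (Hp : posdef H) z : 0 <= dotp (H *m z) z.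
Proof.
have [->|z0] := eqVneq z 0; first by rewrite mulmx0 dotp0l.
exact/ltW/Hp.2.
Qed.

(** A row vector killing [H] becomes, by symmetry, a nonzero vector on which the form vanishes. *)
Lemma posdef_unit {H} (Hp : posdef H) : H \in unitmx.
Proof.
case: Hp => Hs Hp; rewrite unitmxE unitfE; apply/det0P => -[v v0 vH].
have vT0 : v^T != 0 by apply: contraNneq v0 => e; rewrite -(trmxK v) e trmx0.
by have := Hp _ vT0; rewrite -{1}Hs -trmx_mul vH trmx0 dotp0l ltxx.
Qed.

Lemma mulmx_inv {H} (Hp : posdef H) h : H *m (invmx H *m h) = h.
Proof. by rewrite mulKVmx// posdef_unit. Qed.

Lemma dual_ge0 {H} (Hp : posdef H) h : 0 <= dotp h (invmx H *m h).
Proof. by rewrite -{1}(mulmx_inv Hp h) posdef_ge0. Qed.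

Lemma lnorm_sq {H} (Hp : posdef H) z : lnorm H z ^+ 2 = dotp (H *m z) z.
Proof. by rewrite sqr_sqrtr// posdef_ge0. Qed.

Lemma dnorm_sq {H} (Hp : posdef H) h : dnorm H h ^+ 2 = dotp h (invmx H *m h).
Proof. by rewrite sqr_sqrtr// dual_ge0. Qed.

Lemma dnorm_gt0 {H} (Hp : posdef H) h : h != 0 -> 0 < dnorm H h.
Proof.
move=> h0; rewrite sqrtr_gt0 -{1}(mulmx_inv Hp h); apply: Hp.2.
by apply: contraNneq h0 => e; rewrite -(mulmx_inv Hp h) e mulmx0.
Qed.

(** Expand the form of [H] at [z - t H^-1 h], which is nonnegative. The free [t] leaves both the
    sign and the scaling to the caller. *)
Lemma fenchel_young {H} (Hp : posdef H) t h z :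
  2 * t * dotp h z <= t ^+ 2 * dotp h (invmx H *m h) + dotp (H *m z) z.
Proof.
have := posdef_ge0 Hp (z - t *: (invmx H *m h)).
rewrite mulmxDr mulmxN -scalemxAr (mulmx_inv Hp) !dotp_lin.
rewrite (dotp_sym Hp.1 z) (mulmx_inv Hp); lra.
Qed.

Lemma loewner_le_scalarl {H mu} : loewner_le mu%:M H ->
  forall z, mu * dotp z z <= dotp (H *m z) z.
Proof.
by case=> _ + z => /(_ z); rewrite mulmxBl mul_scalar_mx !dotp_lin subr_ge0.
Qed.

Lemma loewner_le_scalarr {H L} : loewner_le H L%:M ->
  forall z, dotp (H *m z) z <= L * dotp z z.
Proof.
by case=> _ + z => /(_ z); rewrite mulmxBl mul_scalar_mx !dotp_lin subr_ge0.
Qed.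

(* Expand [|h - mu H^-1 h|^2 >= 0]. *)
Lemma dual_le {H mu} : posdef H -> loewner_le mu%:M H ->
  forall h, mu * dotp h (invmx H *m h) <= dotp h h.
Proof.
move=> Hp /loewner_le_scalarl Hmu h; set g := invmx H *m h.
have := Hmu g; rewrite (mulmx_inv Hp) => Hg.
have := dotp_ge0 (h - mu *: g); rewrite !dotp_lin (dotpC g h).
have [mu0|mu0] := lerP 0 mu; first by have := ler_wpM2l mu0 Hg; lra.
by have := dotp_ge0 h; have := dual_ge0 Hp h; rewrite -/g; nra.
Qed.

(* Expand [Q (h - L H^-1 h) >= 0] for the quadratic form [Q] of [H]. *)
Lemma dual_ge {H L} : 0 < L -> posdef H -> loewner_le H L%:M ->
  forall h, dotp h h <= L * dotp h (invmx H *m h).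
Proof.
move=> L0 Hp /loewner_le_scalarr HL h; set g := invmx H *m h.
rewrite -(ler_pM2l L0).
have := posdef_ge0 Hp (h - L *: g).
rewrite mulmxDr mulmxN -scalemxAr (mulmx_inv Hp) !dotp_lin.
by rewrite (dotp_sym Hp.1 h) (mulmx_inv Hp); have := HL h; lra.
Qed.

(** A crude count over the [n * n] entries, [|A|] being the largest absolute entry. It serves only
    in local and compactness arguments, where any finite factor will do. *)
Lemma quad_form_bound A z :
  `|dotp (A *m z) z| <= (n * n)%:R * `|A| * dotp z z.
Proof.
have coord i : z i 0 ^+ 2 <= dotp z z.
  rewrite dotpE (bigD1 i)//= expr2 lerDl sumr_ge0// => j _.
  by rewrite -expr2 sqr_ge0.
have term i j : `|A i j * z j 0 * z i 0| <= `|A| * dotp z z.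
  have zz : `|z j 0 * z i 0| <= dotp z z.
    have := coord i; have := coord j.
    by rewrite ler_norml; have := sqr_ge0 (z i 0 + z j 0);
       have := sqr_ge0 (z i 0 - z j 0); nra.
  rewrite -mulrA normrM ler_pM//.
  by rewrite [leRHS]mx_normrE (le_trans _ (le_bigmax _ _ (i, j))).
rewrite dotpE (le_trans (ler_norm_sum _ _ _))//.
have row i : `|(A *m z) i 0 * z i 0| <= n%:R * (`|A| * dotp z z).
  rewrite mxE mulr_suml (le_trans (ler_norm_sum _ _ _))//.
  by rewrite (le_trans (ler_sum _ (fun j _ => term i j)))// sumr_const card_ord mulr_natl.
rewrite (le_trans (ler_sum _ (fun i _ => row i)))// sumr_const card_ord.
rewrite natrM -!mulrA [leRHS]mulr_natl; exact: lexx.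
Qed.

End QuadraticForms.

(** * Derivatives along segments and strong convexity *)

Section SegmentCalculus.
Context {R : realType} {n : nat}.
Implicit Types (f : 'cV[R]_n -> R) (x y d : 'cV[R]_n) (X : set 'cV[R]_n).

Lemma colvec_sum_delta d : d = \sum_i d i 0 *: delta_mx i 0.
Proof. by rewrite {1}(matrix_sum_delta d); apply: eq_bigr => i _; rewrite big_ord1. Qed.

Lemma derive_sum_delta (V : normedModType R) (F : 'cV[R]_n -> V) x d :
  differentiable F x -> 'D_d F x = \sum_i d i 0 *: 'D_(delta_mx i 0) F x.
Proof.
move=> dF; rewrite deriveE// {1}(colvec_sum_delta d) linear_sum.
by apply: eq_bigr => i _; rewrite linearZ deriveE.
Qed.

Lemma derive_grad f x d : differentiable f x -> 'D_d f x = dotp (grad f x) d.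
Proof.
move=> df; rewrite derive_sum_delta// dotpE.
by apply: eq_bigr => i _; rewrite !mxE mulrC.
Qed.

Lemma derive_hess f x d :
  differentiable (grad f) x -> 'D_d (grad f) x = hess f x *m d.
Proof.
move=> df; rewrite derive_sum_delta//; apply/matrixP => i j.
rewrite summxE mxE ord1; apply: eq_bigr => k _.
by rewrite mxE mulrC [in RHS]mxE.
Qed.

Lemma is_derive_segment (V : normedModType R) (F : 'cV[R]_n -> V) x d (t : R) :
  differentiable F (x + t *: d) ->
  is_derive t 1 (fun s : R => F (x + s *: d)) ('D_d F (x + t *: d)).
Proof.
move=> dF; have Fd : derivable F (x + t *: d) d by exact: diff_derivable.
(* The quotient in one variable at [t] and the directional quotient at [x + t *: d] are the same
   function of [h], so no chain rule is involved. *)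
have e : (fun h : R => h^-1 *: (F (x + (h *: (1 : R) + t) *: d) - F (x + t *: d)))
   = (fun h : R => h^-1 *: (F (h *: d + (x + t *: d)) - F (x + t *: d))).
  apply/funext => h; congr (_ *: (F _ - _)).
  by rewrite scalerDl [_%:A]mulr1 addrCA.
apply: DeriveDef; first by rewrite /derivable/= e.
by rewrite /derive/= e.
Qed.

Lemma is_derive_dotp (F : R -> 'cV[R]_n) (d l : 'cV[R]_n) (t : R) :
  is_derive t (1 : R) F l ->
  is_derive t (1 : R) (fun s => dotp (F s) d) (dotp l d).
Proof.
move=> [Fd Fl]; have /derivable_mxP Fij := Fd.
have -> : (fun s => dotp (F s) d) = \sum_i (d i 0 \*: (fun s => F s i 0)).
  apply/funext => s; rewrite dotpE fct_sumE.
  by apply: eq_bigr => i _; rewrite mulrC.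
rewrite -Fl derive_mx// dotpE; apply: is_derive_eq.
  apply: is_derive_sum => i; apply: is_deriveZ.
  by apply: DeriveDef; [exact: Fij|reflexivity].
by apply: eq_bigr => i _; rewrite mxE mulrC.
Qed.

(** Mean value theorem on [[0, t]]. The sign of [psi] is asked only on [[0, 1]], because a segment
    is known to stay in [X] only for those parameters. *)
Lemma ge0_of_derive_ge0 (phi psi : R -> R) :
  (forall t, is_derive t (1 : R) phi (psi t)) -> phi 0 = 0 ->
  (forall t, 0 <= t <= 1 -> 0 <= psi t) -> forall t, 0 <= t <= 1 -> 0 <= phi t.
Proof.
move=> dphi phi0 psi0 t /andP[t0 t1].
have [->|tn0] := eqVneq t 0; first by rewrite phi0.
have tp : 0 < t by rewrite lt_neqAle eq_sym tn0.
have [s /[!in_itv]/= /andP[s0 st]] := @MVT R phi psi 0 t tp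
  (fun s _ => dphi s) (derivable_within_continuous (fun s _ => @ex_derive _ _ _ _ _ _ _ (dphi s))).
rewrite phi0 !subr0 => ->; rewrite mulr_ge0// psi0// ltW//=.
by rewrite ltW// (lt_le_trans st).
Qed.

Lemma convex_set_segment X x y (t : R) : convex_set X -> X x -> X y ->
  0 <= t <= 1 -> X (t *: x + (1 - t) *: y).
Proof.
move=> cX Xx Xy /andP[t0 t1].
by have /set_mem := cX x y (Itv01 t0 t1) (mem_set Xx) (mem_set Xy).
Qed.

(** The defect [phi] of the inequality along the segment from [x] has derivative [psi] and second
    derivative [xi]. The Hessian bound gives [xi >= 0], and both [psi] and [phi] vanish at 0, so two
    integrations of the sign give [phi 1 >= 0]. *)
Lemma strong_convexity f X mu x y : twice_differentiable f -> convex_set X ->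
  (forall z, X z -> loewner_le mu%:M (hess f z)) -> X x -> X y ->
  f x + dotp (grad f x) (y - x) + mu / 2 * dotp (y - x) (y - x) <= f y.
Proof.
move=> [df dg] cX Hmu Xx Xy; set d := y - x.
pose phi t := f (x + t *: d) - f x - t * dotp (grad f x) d
                - t ^+ 2 * (mu / 2 * dotp d d).
pose psi t := dotp (grad f (x + t *: d)) d - dotp (grad f x) d
                - t * (mu * dotp d d).
pose xi t := dotp (hess f (x + t *: d) *m d) d - mu * dotp d d.
have Xseg t : 0 <= t <= 1 -> X (x + t *: d).
  move=> /(convex_set_segment X y x t cX Xy Xx).
  by rewrite /d scalerBr scalerBl scale1r addrCA.
have dphi t : is_derive t (1 : R) phi (psi t).
  have Df := is_derive_segment _ f x d t (df _).
  have -> : phi = (fun s => f (x + s *: d)) - cst (f x)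
      - (dotp (grad f x) d) \*: id - (mu / 2 * dotp d d) \*: (id * id).
    by apply/funext => s; rewrite /phi !fctE /=; congr (_ - _ - _); rewrite mulrC.
  apply: is_derive_eq; rewrite derive_grad// /psi.
  rewrite subr0 /GRing.scale/=; lra.
have dpsi t : is_derive t (1 : R) psi (xi t).
  have Dg := is_derive_dotp _ d _ t (is_derive_segment _ (grad f) x d t (dg _)).
  have -> : psi = (fun s => dotp (grad f (x + s *: d)) d)
      - cst (dotp (grad f x) d) - (mu * dotp d d) \*: id.
    by apply/funext => s; rewrite /psi !fctE /=; congr (_ - _ - _); rewrite mulrC.
  apply: is_derive_eq; rewrite derive_hess// /xi.
  by rewrite subr0 /GRing.scale/= mulr1.
have psi0 : psi 0 = 0 by rewrite /psi scale0r addr0 subrr mul0r subr0.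
have phi0 : phi 0 = 0.
  by rewrite /phi scale0r addr0 subrr mul0r expr0n mul0r !subr0.
have xi_ge0 t : 0 <= t <= 1 -> 0 <= xi t.
  by move=> /Xseg/Hmu Ht; rewrite subr_ge0; exact: loewner_le_scalarl.
have := ge0_of_derive_ge0 _ _ dphi phi0 (ge0_of_derive_ge0 _ _ dpsi psi0 xi_ge0).
move=> /(_ 1); rewrite ler01 lexx => /(_ isT).
by rewrite /phi scale1r /d subrKC; lra.
Qed.

End SegmentCalculus.

(** * Feasibility and stopping test of the inner procedures *)

Section InnerRuns.
Context {R : realType} {n : nat}.
Implicit Types (X : set 'cV[R]_n) (H : 'M[R]_n) (h u x y v : 'cV[R]_n).
Implicit Types (a b : active R n).

(** Dividing by the total weight makes the induction apply to a tail of arbitrary positive weight;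
    the head is then mixed with the normalized tail. *)
Lemma convex_set_combination X (s : seq 'cV[R]_n) (F : 'cV[R]_n -> R) :
  convex_set X -> (forall w, w \in s -> X w) -> (forall w, 0 <= F w) ->
  0 < \sum_(w <- s) F w ->
  X ((\sum_(w <- s) F w)^-1 *: \sum_(w <- s) F w *: w).
Proof.
move=> cX + F0; elim: s => [|v s IH] Xs; first by rewrite big_nil ltxx.
rewrite !big_cons; set S := \sum_(w <- s) F w; set T := \sum_(w <- s) F w *: w.
have Xv : X v by apply: Xs; rewrite mem_head.
have S0 : 0 <= S by apply: sumr_ge0.
(* A tail of total weight 0 cannot be normalized, but all its weights vanish and the combination is
   [v] itself. *)
have [Sz|Snz] := eqVneq S 0.
  have -> : T = 0.
    rewrite /T big1_seq// => w /andP[_ ws].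
    move/eqP: Sz; rewrite psumr_eq0; last by move=> ? _; exact: F0.
    by move=> /allP/(_ _ ws)/= /eqP->; rewrite scale0r.
  rewrite Sz !addr0 => Fv0; rewrite scalerA mulVf ?scale1r//.
  by rewrite gt_eqF.
have Sp : 0 < S by rewrite lt_neqAle eq_sym Snz.
move=> FS0; have FSnz : F v + S != 0 by rewrite gt_eqF.
have XT : X (S^-1 *: T).
  by apply: IH => // w ws; apply: Xs; rewrite in_cons ws orbT.
have t01 : 0 <= F v / (F v + S) <= 1.
  by rewrite divr_ge0 ?(ltW FS0)//= ler_pdivrMr// mul1r lerDl.
have := convex_set_segment X _ _ _ cX Xv XT t01.
congr X; rewrite scalerDr !scalerA; congr (_ *: _ + _ *: _).
  by rewrite mulrC.
by field; rewrite Snz FSnz.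
Qed.

Lemma is_argmin_gap X g x v eta : is_argmin X (dotp g) v ->
  dotp g (x - v) <= eta -> forall w, X w -> dotp g (x - w) <= eta.
Proof.
by move=> [_ vmin] gap w /vmin vw; move: gap; rewrite !dotp_lin; lra.
Qed.

(** Induction on the run: the stopping test is the only exit, and a failed test has gap above
    [eta >= 0], so the step size lies in [[0, 1]] and the next iterate is a convex combination. *)
Lemma fw_run_returns X h H u eta x y : convex_set X -> 0 <= eta ->
  fw_run X h H u eta x y -> X x ->
  X y /\ forall v, X v -> dotp (model_grad h H u y) (y - v) <= eta.
Proof.
move=> cX eta0; elim=> {x y} [x v vmin gap Xx|x v y vmin gap _ IH Xx].
  by split=> //; exact: is_argmin_gap vmin gap.
apply: IH; set g := fw_stepsize h H u x v.
have g01 : 0 <= 1 - g <= 1.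
  rewrite subr_ge0 gerBl /g /fw_stepsize ge_min lexx/= le_min ler01/=.
  by rewrite divr_ge0 ?sqr_ge0// (le_trans eta0 (ltW gap)).
have := convex_set_segment X _ _ _ cX Xx vmin.1 g01.
by rewrite subKr.
Qed.

(* The support of the weights only matters through a duplicate-free list that
   is allowed to keep dropped atoms, so that away steps need no bookkeeping. *)
Definition active_spec X a x := exists s : seq 'cV[R]_n,
  [/\ uniq s /\ (forall w, w \in s -> X w),
      (forall w, (w \in act_set a)%fset -> w \in s),
      (forall w, 0 <= act_wgt a w) /\ (forall w, w \notin s -> act_wgt a w = 0),
      \sum_(w <- s) act_wgt a w = 1 &
      x = \sum_(w <- s) act_wgt a w *: w].

Lemma active_spec_mem X a x : convex_set X -> active_spec X a x -> X x.
Proof.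
move=> cX [s [[_ Xs] _ [w0 _] w1 ->]].
have := convex_set_combination X s _ cX Xs w0.
by rewrite w1 invr1 scale1r; apply.
Qed.

Lemma sum_indicator (s : seq 'cV[R]_n) v (g : R) : uniq s -> v \in s ->
  \sum_(w <- s) (if w == v then g else 0) = g.
Proof.
move=> us vs; rewrite (bigD1_seq v)//= eqxx big1 ?addr0// => w.
by move=> /negPf->.
Qed.

Lemma sum_indicator_scale (s : seq 'cV[R]_n) v (g : R) : uniq s -> v \in s ->
  \sum_(w <- s) (if w == v then g else 0) *: w = g *: v.
Proof.
move=> us vs; rewrite (bigD1_seq v)//= eqxx big1 ?addr0// => w.
by move=> /negPf->; rewrite scale0r.
Qed.

(** A missing [v] is listed with weight 0, so that a Frank-Wolfe step always moves weight within a
    fixed list. *)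
Lemma active_spec_extend X a x v : active_spec X a x -> X v ->
  exists s : seq 'cV[R]_n,
  [/\ uniq s /\ (forall w, w \in s -> X w),
      (forall w, (w \in act_set a)%fset -> w \in s),
      (forall w, 0 <= act_wgt a w) /\ (forall w, w \notin s -> act_wgt a w = 0),
      \sum_(w <- s) act_wgt a w = 1 &
      x = \sum_(w <- s) act_wgt a w *: w] /\ v \in s.
Proof.
move=> [s [[us Xs] sub [w0 wz] w1 xE]] Xv.
have [vs|vs] := boolP (v \in s); first by exists s.
exists (v :: s); rewrite mem_head; split=> //; split.
- split; first by rewrite /= vs us.
  by move=> w; rewrite in_cons => /predU1P[->//|/Xs].
- by move=> w /sub; rewrite in_cons => ->; rewrite orbT.
- by split=> // w; rewrite in_cons negb_or => /andP[_ /wz].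
- by rewrite big_cons wz// add0r.
- by rewrite big_cons wz// scale0r add0r.
Qed.

Lemma active_spec_fw X a x v (g : R) : active_spec X a x -> X v ->
  0 <= g <= 1 -> active_spec X (fw_active g v a) (x - g *: (x - v)).
Proof.
move=> ax Xv /andP[g0 g1].
have [s [[[us Xs] sub [w0 wz] w1 xE] vs]] := active_spec_extend _ _ _ _ ax Xv.
exists s; split=> //=.
- move=> w; case: ifP => _; first by rewrite in_fset1 => /eqP->.
  by rewrite in_fset1U => /predU1P[->//|/sub].
- split=> w; first by rewrite addr_ge0 ?mulr_ge0 ?subr_ge0//; case: ifP.
  move=> ws; rewrite wz// mulr0 add0r; case: eqP => // wv.
  by rewrite wv vs in ws.
- by rewrite big_split/= -mulr_sumr w1 sum_indicator// mulr1 subrK.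
- under eq_bigr do rewrite scalerDl -scalerA.
  rewrite big_split/= -scaler_sumr -xE sum_indicator_scale//.
  by rewrite scalerBl scale1r scalerBr opprB addrA addrAC.
Qed.

Lemma active_spec_away X a x v (g : R) : active_spec X a x ->
  (v \in act_set a)%fset ->
  0 <= g <= act_wgt a v / (1 - act_wgt a v) ->
  active_spec X (away_active g v a) (x - g *: (v - x)).
Proof.
move=> [s [[us Xs] sub [w0 wz] w1 xE]] /[dup] va /sub vs /andP[g0 g1].
have wv1 : act_wgt a v <= 1.
  by rewrite -w1 (bigD1_seq v)//= lerDl sumr_ge0.
exists s; split=> //=.
- by move=> w; case: ifP => _; rewrite ?in_fsetD1; [case/andP=> _|]; exact: sub.
- split=> w; last first.
    move=> ws; rewrite wz// mulr0 sub0r; case: eqP => [wv|]; last by rewrite oppr0.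
    by rewrite wv vs in ws.
  case: eqP => [->|_]; last by rewrite subr0 mulr_ge0// addr_ge0.
  (* At weight 1 the bound on [g] has denominator 0, but the new weight is 1 for any [g]. Otherwise
     [g (1 - w) <= w] is exactly nonnegativity of the new weight. *)
  have [wv|wv] := eqVneq (act_wgt a v) 1.
    by rewrite wv mulr1 addrK.
  have wv0 : 0 < 1 - act_wgt a v by rewrite subr_gt0 lt_neqAle wv.
  by move: g1; rewrite ler_pdivlMr//; lra.
- rewrite big_split/= -mulr_sumr w1 sumrN sum_indicator//; lra.
- under eq_bigr do rewrite scalerBl -scalerA.
  rewrite big_split/= -scaler_sumr -xE sumrN sum_indicator_scale//.
  by rewrite scalerDl scale1r scalerBr opprB addrA.
Qed.

(** As for plain Frank-Wolfe, with the convex decomposition as invariant: membership in [X] alone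
    would not survive away steps, whose direction leaves from [vA]. *)
Lemma afw_run_returns X h H u eta x a y b : convex_set X -> 0 <= eta ->
  afw_run X h H u eta x a y b -> active_spec X a x ->
  active_spec X b y /\ forall v, X v -> dotp (model_grad h H u y) (y - v) <= eta.
Proof.
move=> cX eta0; elim=> {x a y b}.
- move=> x a v vmin _ gap ax; split=> //; exact: is_argmin_gap vmin gap.
- move=> x a v vA y b vmin _ gap _ _ _; set g := afw_stepsize _ _ _ _ _ _.
  move=> /= IH ax; apply: IH.
  apply: active_spec_fw vmin.1 _ => //.
  rewrite /g /afw_stepsize ge_min lexx/= andbT le_min ler01/=.
  by rewrite divr_ge0 ?sqr_ge0// (le_trans eta0 (ltW gap)).
- move=> x a v vA y b vmin _ gap vAmax away _; cbv zeta; set gmax := act_wgt a vA / _.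
  set g := afw_stepsize _ _ _ _ _ _ => /= IH ax; apply: IH.
  have vAs := vAmax.1; apply: active_spec_away => //.
  have [s [[us _] sub [w0 _] w1 _]] := ax.
  have wv1 : act_wgt a vA <= 1.
    by rewrite -w1 (bigD1_seq vA)//= ?lerDl ?sumr_ge0//; exact: sub.
  rewrite /g /afw_stepsize ge_min lexx/= andbT le_min /gmax.
  rewrite divr_ge0 ?subr_ge0//= divr_ge0 ?sqr_ge0//.
  (* The away gap exceeds the Frank-Wolfe gap, which exceeds [eta], so the step size is
     nonnegative. *)
  by rewrite (le_trans eta0)// (le_trans (ltW gap)) ?ltW.
Qed.

End InnerRuns.

(** * Uniform Hessian bounds on a compact set *)

Section HessianBounds.
Context {R : realType} {n : nat}.
Implicit Types (f : 'cV[R]_n -> R) (X : set 'cV[R]_n) (H : 'M[R]_n) (x y z : 'cV[R]_n).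

(** Avoids eigenvalues: [C] bounds the form of the inverse, and [fenchel_young] with [h = z] and
    [t = 1 / C] absorbs half of the left side. *)
Lemma posdef_coercive {H} : posdef H ->
  exists2 C : R, 0 < C & forall z, dotp z z <= C * dotp (H *m z) z.
Proof.
move=> Hp; pose C := (n * n)%:R * `|invmx H| + 1.
have C0 : 0 < C by rewrite ltr_wpDl.
exists C => // z.
have zinv : dotp z (invmx H *m z) <= C * dotp z z.
  rewrite dotpC (le_trans (ler_norm _))// (le_trans (quad_form_bound _ _))//.
  by rewrite ler_wpM2r ?dotp_ge0// lerDl.
have := fenchel_young Hp C^-1 z z.
have := ler_wpM2l (sqr_ge0 C^-1) zinv.
have : C^-1 ^+ 2 * (C * dotp z z) = C^-1 * dotp z z by field; rewrite gt_eqF.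
by move=> e h1 h2; rewrite -ler_pdivrMl//; lra.
Qed.

Lemma dotp_le_norm z : dotp z z <= n%:R * `|z| ^+ 2.
Proof.
rewrite dotpE (le_trans (ler_sum _ (_ : forall i, true -> _ <= `|z| ^+ 2)))//.
  move=> i _; rewrite -expr2 -real_normK ?num_real// lerXn2r ?nnegrE//.
  by rewrite [leRHS]mx_normrE (le_trans _ (le_bigmax _ _ (i, 0))).
by rewrite sumr_const card_ord mulr_natl.
Qed.

Lemma lnorm_small H x (d : R) : posdef H -> 0 < d ->
  \forall y \near x, lnorm H (x - y) <= d.
Proof.
move=> Hp d0; pose K := (n * n)%:R * `|H| * n%:R + 1.
have K0 : 0 < K by rewrite ltr_wpDl.
(* Within radius 1 the squared norm is at most the norm, so a radius linear in [d ^+ 2] suffices. *)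
apply/nbhs_ballP; exists (Num.min 1 (d ^+ 2 / K)) => /=.
  by rewrite lt_min ltr01 divr_gt0 ?exprn_gt0.
move=> y; rewrite -ball_normE /= lt_min => /andP[z1 zd].
rewrite -(ler_pXn2r (_ : 0 < 2)%N) ?nnegrE ?sqrtr_ge0 ?(ltW d0)//.
rewrite lnorm_sq// (le_trans (ler_norm _))// (le_trans (quad_form_bound _ _))//.
rewrite (le_trans (ler_wpM2l _ (dotp_le_norm _)))// ?mulr_ge0//.
move: zd; rewrite ltr_pdivlMr// => /ltW; apply: le_trans.
rewrite mulrA [leRHS]mulrC ler_pM ?exprn_ge0 ?mulr_ge0//.
  by rewrite lerDl.
by rewrite expr2 ler_piMl// ltW.
Qed.

(** Local comparison of Hessians for [p = 2], drawn from the Hölder bound itself; [0 < nu] makes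
    that bound small near [x]. *)
Lemma hess_near2 f X (nu M : R) x : (forall x, X x -> posdef (hess f x)) ->
  0 < nu -> 0 < M -> holder2 f X nu M -> X x ->
  \forall y \near x, X y -> forall z,
    2 * `|dotp ((hess f y - hess f x) *m z) z| <= dotp (hess f x *m z) z.
Proof.
(* This [d] solves [M * d ^ nu = 1 / 2]. *)
move=> fp nu0 M0 hf Xx; pose d := (2 * M)^-1 `^ nu^-1.
have M20 : 0 < (2 * M)^-1 by rewrite invr_gt0 mulr_gt0.
have d0 : 0 < d by rewrite powR_gt0.
near=> y => Xy z.
have small : lnorm (hess f x) (x - y) <= d.
  by near: y; exact: lnorm_small (fp x Xx) d0.
have [->|z0] := eqVneq z 0; first by rewrite !mulmx0 !dotp0l normr0 mulr0.
have lz : 0 < lnorm (hess f x) z by rewrite sqrtr_gt0 (fp x Xx).2.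
pose w := (hess f x - hess f y) *m z.
have wz : dnorm (hess f x) w / lnorm (hess f x) z <= 2^-1.
  rewrite -lee_fin; apply: (le_trans _ (le_trans (hf x y Xx Xy) _)).
    by apply: ereal_sup_ubound; exists z.
  rewrite lee_fin.
  have : lnorm (hess f x) (x - y) `^ nu <= (2 * M)^-1.
    rewrite (le_trans (ge0_ler_powR (ltW nu0) _ _ small)) ?nnegrE ?sqrtr_ge0 ?(ltW d0)//.
    by rewrite -powRrM mulVf ?gt_eqF// powRr1// ltW.
  move=> /(ler_wpM2l (ltW M0)) MP; apply: (le_trans MP).
  by rewrite invfM mulrCA mulfV ?gt_eqF// mulr1.
have : dnorm (hess f x) w ^+ 2 <= 4^-1 * dotp (hess f x *m z) z.
  move: wz; rewrite ler_pdivrMr// => wz; rewrite -(lnorm_sq (fp x Xx)).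
  have -> : 4^-1 = 2^-1 ^+ 2 :> R by field.
  rewrite -exprMn lerXn2r// ?nnegrE ?sqrtr_ge0// mulr_ge0// ?invr_ge0//.
  exact: sqrtr_ge0.
rewrite (dnorm_sq (fp x Xx)) => wz2.
have -> : (hess f y - hess f x) *m z = - w by rewrite -mulNmx opprB.
rewrite dotpNl normrN.
(* With [t = 2] and [t = -2], and the dual square of [w] at most a quarter of the form at [z], four
   times [|<w, z>|] is at most twice that form. *)
have := fenchel_young (fp x Xx) 2 w z; have := fenchel_young (fp x Xx) (-2) w z.
case: ler0P => _; lra.
Unshelve. all: by end_near. Qed.

(** Counterpart for [p = 3], where differentiability of the Hessian supplies its continuity. *)
Lemma hess_near3 f x : posdef (hess f x) -> differentiable (hess f) x ->
  \forall y \near x, forall z,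
    2 * `|dotp ((hess f y - hess f x) *m z) z| <= dotp (hess f x *m z) z.
Proof.
move=> fp /differentiable_continuous cf; have [C C0 Cz] := posdef_coercive fp.
(* Collects the factor 2 of the goal, the entry count of [quad_form_bound] and the coercivity
   constant; the added 1 keeps [K] positive. *)
pose K : R := (2 * ((n * n)%:R + 1)) * C.
have K0 : 0 < K by rewrite !mulr_gt0// ltr_wpDl.
near=> y => z.
have small : `|hess f x - hess f y| <= K^-1.
  near: y; move/cvgrPdist_le : cf; apply; by rewrite invr_gt0.
have Q0 : 0 <= dotp (hess f x *m z) z by exact: posdef_ge0.
have KA : K * `|hess f x - hess f y| <= 1.
  by rewrite -ler_pdivlMl// mulr1.
rewrite (le_trans (ler_wpM2l _ (quad_form_bound _ _)))// distrC.
have := ler_wpM2r Q0 KA; rewrite mul1r; apply: le_trans.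
have -> : K * `|hess f x - hess f y| * dotp (hess f x *m z) z =
  2 * (((n * n)%:R + 1) * `|hess f x - hess f y| * (C * dotp (hess f x *m z) z)).
  by rewrite /K; ring.
rewrite ler_wpM2l// ler_pM// ?mulr_ge0 ?dotp_ge0// ler_wpM2r// lerDl//.
Unshelve. all: by end_near. Qed.

(** Closeness puts [Qy] between [Qx / 2] and [3 Qx / 2], which transfers both bounds at [x] to the
    neighbour [y]. *)
Lemma quad_form_sandwich (Qx Qy zz C K m : R) :
  0 < C -> zz <= C * Qx -> 2 * Qx <= K * zz -> 0 <= Qy -> 0 <= zz ->
  2 * C <= m -> K <= m -> 2 * `|Qy - Qx| <= Qx ->
  zz <= m * Qy /\ Qy <= m * zz.
Proof.
move=> C0 Cx Kx Qy0 zz0 mC mK close.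
have mQ := ler_wpM2r Qy0 mC; have mz := ler_wpM2r zz0 mK.
have Q2 : Qx <= 2 * Qy by move: close; case: ler0P; lra.
have := ler_wpM2l (ltW C0) Q2.
by move: close; case: ler0P; split; lra.
Qed.

Lemma hessian_bounds_exist f X p (nu M : R) : compact X ->
  twice_differentiable f -> (forall x, X x -> posdef (hess f x)) ->
  2 < p%:R + nu -> 0 < M -> holder_condition p f X nu M ->
  exists mu L : R, [/\ 0 < mu, 0 < L & hessian_bounds f X mu L].
Proof.
move=> cX f2 fp q2 M0 hf.
have near_hess x : X x -> \forall y \near x, X y -> forall z,
    2 * `|dotp ((hess f y - hess f x) *m z) z| <= dotp (hess f x *m z) z.
  move: hf; rewrite /holder_condition; case: p q2 => [|[|[|[|//]]]]// q2.
    by move=> hf Xx; apply: (hess_near2 f X nu M) => //; lra.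
  move=> [[_ f3] _ _ _] Xx; near do move=> _.
  by apply: hess_near3 => //; exact: fp.
have : \forall m \near +oo, X `<=` [set y | forall z,
   dotp z z <= m * dotp (hess f y *m z) z /\ dotp (hess f y *m z) z <= m * dotp z z].
  (* The covering form of compactness: a bound valid for [y] near each [x] and [m] large holds for
     one large [m] on all of [X]. *)
  move/compact_near_coveringP/near_covering_withinP : cX; apply => x Xx.
  have [C C0 Cz] := posdef_coercive (fp x Xx).
  pose K := 2 * ((n * n)%:R * `|hess f x|).
  have K0 : 0 <= K by rewrite !mulr_ge0.
  have near_x := near_hess x Xx; near=> y m => Xy /= z.
  have close : 2 * `|dotp (hess f y *m z) z - dotp (hess f x *m z) z|
      <= dotp (hess f x *m z) z.
    have -> : dotp (hess f y *m z) z - dotp (hess f x *m z) z =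
        dotp ((hess f y - hess f x) *m z) z by rewrite mulmxBl !dotp_lin.
    exact: (near near_x y).
  have mC : 2 * C <= m by near: m; apply: nbhs_pinfty_ge; rewrite num_real.
  have mK : K <= m by near: m; apply: nbhs_pinfty_ge; rewrite num_real.
  have Cx := Cz z.
  have Kx : 2 * dotp (hess f x *m z) z <= K * dotp z z.
    rewrite -mulrA ler_wpM2l// (le_trans (ler_norm _))//.
    exact: quad_form_bound.
  have Qy := posdef_ge0 (fp y Xy) z.
  exact: (quad_form_sandwich _ _ _ _ _ _ C0 Cx Kx Qy (dotp_ge0 z) mC mK close).
move=> Xm; near +oo_R => m.
have m0 : 0 < m by near: m; apply: nbhs_pinfty_gt; rewrite num_real.
(* One [m] serves both sides, as [L] and as the inverse of [mu]. *)
exists m^-1, m; rewrite invr_gt0 m0; split=> // y Xy.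
have Hs : (hess f y)^T = hess f y by have [] := fp y Xy.
have : forall z, dotp z z <= m * dotp (hess f y *m z) z /\
    dotp (hess f y *m z) z <= m * dotp z z.
  by move: Xy; move: y {Hs}; near: m; exact: Xm.
move=> mz; split; split.
- by rewrite linearB/= tr_scalar_mx Hs.
- move=> z; rewrite mulmxBl mul_scalar_mx !dotp_lin subr_ge0 ler_pdivrMl//.
  exact: (mz z).1.
- by rewrite linearB/= tr_scalar_mx Hs.
- by move=> z; rewrite mulmxBl mul_scalar_mx !dotp_lin subr_ge0; exact: (mz z).2.
Unshelve. all: by end_near. Qed.

End HessianBounds.

(** * Scalar inequalities for the potential *)

Section PotentialArithmetic.
Context {R : realType}.
Implicit Types (a b rho D E : R).

Lemma exponents_spec {q : R} : 2 < q ->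
  [/\ 0 < (q - 2) / (q - 1), 0 < q / (q - 1) &
      (q - 2) / (q - 1) + q / (q - 1) = 2].
Proof.
by move=> q2; split; [rewrite divr_gt0; lra..|field; rewrite gt_eqF//; lra].
Qed.

(** The bound by [P0] is carried along because the rate [d] is computed from the initial potential
    and is valid only below it. *)
Lemma contraction_iter {d P P' P0 : R} {i : nat} :
  0 <= d -> 0 <= P' -> (1 + d) * P' <= P -> P <= P0 -> P <= (1 + d) ^- i * P0 ->
  P' <= P0 /\ P' <= (1 + d) ^- i.+1 * P0.
Proof.
move=> d0 P'0 contr PP0 Pi; split; first by have := mulr_ge0 d0 P'0; lra.
by rewrite exprS invfM -mulrA ler_pdivlMl ?(le_trans contr)// ltr_pwDl.
Qed.

Lemma powR_split2 {a b D} : a + b = 2 -> 0 < D -> D `^ a * D `^ b = D ^+ 2.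
Proof.
move=> ab D0; rewrite -powRD ?ab ?powR_mulrn ?ltW//.
by apply/implyP => _; rewrite gt_eqF.
Qed.

Lemma one_sub_powR_gt0 {b rho} : 0 < b -> 0 < rho -> rho < 1 -> 0 < 1 - rho `^ b.
Proof.
move=> b0 r0 r1; rewrite subr_gt0.
have -> : 1 = 1 `^ b :> R by rewrite powR1.
by rewrite gt0_ltr_powR ?nnegrE ?ltW.
Qed.

(* Both endpoints of the interval for [chi] reduce, through
   [rho ^ a * rho ^ b = rho ^ 2], to the assumed bound on [omega]. *)
Lemma chi_interval {a b rho B g omega} : a + b = 2 -> 0 < b -> 0 < rho < 1 ->
  0 < B -> 0 < omega < g * rho ^+ 2 * (1 - rho `^ b) ->
  omega / (B * (1 - rho `^ b)) < rho `^ a / B * (g - omega / rho ^+ 2).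
Proof.
move=> ab b0 /andP[r0 r1] B0 /andP[w0].
have ra0 : 0 < rho `^ a by rewrite powR_gt0.
have rb0 : 0 < rho `^ b by rewrite powR_gt0.
have rb1 : 0 < 1 - rho `^ b.
  exact: one_sub_powR_gt0.
rewrite -(powR_split2 ab r0); move: ra0 rb0 rb1.
set u := rho `^ a; set v := rho `^ b => u0 v0 v1 wlt.
rewrite -subr_gt0.
have -> : u / B * (g - omega / (u * v)) - omega / (B * (1 - v)) =
  (g * (u * v) * (1 - v) - omega) / (B * v * (1 - v)).
  by field; rewrite !gt_eqF.
by rewrite divr_gt0 ?subr_gt0// !mulr_gt0.
Qed.

(** Each entry of the minimum uses one end of the interval: the upper end gives the first, the lower
    end the second. *)
Lemma descent_constant_gt0 {a b rho B g omega chi} : a + b = 2 -> 0 < b -> 0 < rho < 1 ->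
  0 < B ->
  omega / (B * (1 - rho `^ b)) < chi < rho `^ a / B * (g - omega / rho ^+ 2) ->
  0 < Num.min (g / B - omega / (B * rho ^+ 2) - chi * rho `^ (- a))
        ((chi * (1 - rho `^ b) - omega / B) / rho ^+ 2).
Proof.
move=> ab b0 /andP[r0 r1] B0 /andP[clo chi_hi].
have ra0 : 0 < rho `^ a by rewrite powR_gt0.
have rb1 : 0 < 1 - rho `^ b.
  exact: one_sub_powR_gt0.
have r20 : 0 < rho ^+ 2 by rewrite exprn_gt0.
rewrite lt_min; apply/andP; split.
  rewrite powRN subr_gt0 ltr_pdivrMr// (lt_le_trans chi_hi)//.
  rewrite le_eqVlt; apply/orP; left; apply/eqP; field.
  by rewrite !gt_eqF.
rewrite divr_gt0// subr_gt0 -ltr_pdivrMr// (le_lt_trans _ clo)//.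
by rewrite invfM mulrA.
Qed.

(** Here [D] and [E] stand for consecutive values of Delta, [N] for the dual norm of the new
    residual at the new point, and [F], [F'] for the optimality gaps. *)
Lemma potential_decrease {a b rho B g omega chi D N E F F' : R} :
  a + b = 2 -> 0 < a -> 0 < b -> 0 < rho -> 0 < B -> 0 <= g -> 0 <= omega -> 0 < chi ->
  0 < D -> 0 <= N -> E = Num.max N (rho * D) ->
  (g * N ^+ 2 - omega * D ^+ 2) / (B * D `^ a) <= F - F' ->
  Num.min (g / B - omega / (B * rho ^+ 2) - chi * rho `^ (- a))
        ((chi * (1 - rho `^ b) - omega / B) / rho ^+ 2) * (E ^+ 2 / D `^ a)
   <= (F + chi * D `^ b) - (F' + chi * E `^ b).
Proof.
move=> ab a0 b0 r0 B0 g0 w0 chi0 D0 N0 defE dec.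
have rD0 : 0 < rho * D by rewrite mulr_gt0.
have ED : rho * D <= E by rewrite defE le_max lexx orbT.
have E0 : 0 < E by exact: lt_le_trans ED.
have Da0 : 0 < D `^ a by rewrite powR_gt0.
have ra0 : 0 < rho `^ a by rewrite powR_gt0.
have Ea0 : 0 < E `^ a by rewrite powR_gt0.
have Db : D `^ b = D ^+ 2 / D `^ a by rewrite -(powR_split2 ab D0) mulrC mulKf ?gt_eqF.
have Eb : E `^ b = E ^+ 2 / E `^ a by rewrite -(powR_split2 ab E0) mulrC mulKf ?gt_eqF.
(* If the residual attains [E], it pays for the increase of [chi * E ^ b];
   otherwise [E = rho * D] and the decrease comes from [chi * D ^ b] alone. *)
have [NE|NE] := leP (rho * D) N.
  have EN : E = N by rewrite defE; apply/max_idPl.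
  have DaE : rho `^ a * D `^ a <= E `^ a.
    by rewrite -powRM ?(ltW r0) ?(ltW D0)// ge0_ler_powR ?nnegrE ?(ltW rD0) ?(ltW E0) ?(ltW a0).
  (* Since [E ^ b = E ^ 2 / E ^ a] and [E >= rho D], this is where the factor [rho ^ (- a)] in the
     constant arises. *)
  have Eb_le : E `^ b <= rho `^ (- a) * (E ^+ 2 / D `^ a).
    rewrite Eb powRN mulrCA ler_pM2l ?exprn_gt0// -invfM.
    by rewrite lef_pV2 ?posrE ?mulr_gt0.
  have D2 : D ^+ 2 <= E ^+ 2 / rho ^+ 2.
    by rewrite ler_pdivlMr ?exprn_gt0// mulrC -exprMn lerXn2r ?nnegrE ?(ltW rD0) ?(ltW E0).
  have split_dec : (g / B - omega / (B * rho ^+ 2)) * (E ^+ 2 / D `^ a) <= F - F'.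
    apply: le_trans dec; rewrite -EN.
    have -> : (g / B - omega / (B * rho ^+ 2)) * (E ^+ 2 / D `^ a) =
        (g * E ^+ 2 - omega * (E ^+ 2 / rho ^+ 2)) / (B * D `^ a).
      by field; rewrite !gt_eqF.
    rewrite ler_pM2r ?invr_gt0 ?mulr_gt0// lerD2l lerN2 ler_wpM2l//.
  have Dbp : 0 <= chi * D `^ b by rewrite mulr_ge0 ?powR_ge0 ?ltW.
  have := ler_wpM2l (ltW chi0) Eb_le; rewrite mulrA => chiE.
  apply: (@le_trans _ _ ((g / B - omega / (B * rho ^+ 2) - chi * rho `^ (- a))
            * (E ^+ 2 / D `^ a))).
    by rewrite ler_wpM2r ?ge_min ?lexx// divr_ge0 ?exprn_ge0// ltW.
  rewrite mulrBl; lra.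
have EN : E = rho * D by rewrite defE; apply/max_idPr/ltW.
have dec0 : - (omega / B) * D `^ b <= F - F'.
  apply: le_trans dec; rewrite Db.
  have -> : - (omega / B) * (D ^+ 2 / D `^ a) = - (omega * D ^+ 2) / (B * D `^ a).
    by field; rewrite !gt_eqF.
  rewrite ler_pM2r ?invr_gt0 ?mulr_gt0// lerBrDr addNr.
  by rewrite mulr_ge0 ?sqr_ge0.
apply: (@le_trans _ _ (((chi * (1 - rho `^ b) - omega / B) / rho ^+ 2)
          * (E ^+ 2 / D `^ a))).
  by rewrite ler_wpM2r ?ge_min ?lexx ?orbT// divr_ge0 ?exprn_ge0// ltW.
have -> : E `^ b = rho `^ b * D `^ b by rewrite EN powRM ?ltW.
have -> : (chi * (1 - rho `^ b) - omega / B) / rho ^+ 2 * (E ^+ 2 / D `^ a) =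
    (chi * (1 - rho `^ b) - omega / B) * D `^ b.
  by rewrite Db EN; field; rewrite !gt_eqF.
rewrite mulrBl; lra.
Qed.

(** The new potential is at most [E ^ b (chi + K E ^ a)]. From [chi E ^ b <= P0] comes
    [E ^ a <= (P0 / chi) ^ (a / b)], and [E >= rho D] makes the decrease at least [C rho ^ a E ^ b];
    the quotient of the two is the rate. *)
Lemma potential_contraction {a b rho K chi C D E F' P P0 : R} :
  a + b = 2 -> 0 < a -> 0 < b -> 0 < rho -> 0 <= K -> 0 < chi -> 0 < C -> 0 < D ->
  rho * D <= E -> 0 <= F' <= K * E ^+ 2 ->
  C * (E ^+ 2 / D `^ a) <= P - (F' + chi * E `^ b) -> P <= P0 ->
  (1 + C * rho `^ a / (chi + K * (P0 / chi) `^ (a / b))) * (F' + chi * E `^ b) <= P.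
Proof.
move=> ab a0 b0 r0 K0 chi0 C0 D0 ED /andP[F0 FE] dec PP0.
have rD0 : 0 < rho * D by rewrite mulr_gt0.
have E0 : 0 < E by exact: lt_le_trans ED.
have Da0 : 0 < D `^ a by rewrite powR_gt0.
have ra0 : 0 < rho `^ a by rewrite powR_gt0.
have Ea0 : 0 < E `^ a by rewrite powR_gt0.
have Eb0 : 0 < E `^ b by rewrite powR_gt0.
have E2D : 0 <= C * (E ^+ 2 / D `^ a) by rewrite mulr_ge0 ?divr_ge0 ?exprn_ge0// ltW.
set P' := F' + chi * E `^ b in dec *.
set Z := (P0 / chi) `^ (a / b).
have EaZ : E `^ a <= Z.
  have -> : a = b * (a / b) by field; rewrite gt_eqF.
  have chiE : chi * E `^ b <= P0 by rewrite (le_trans _ PP0)//; move: dec; rewrite /P'; lra.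
  have EP : E `^ b <= P0 / chi by rewrite ler_pdivlMr// mulrC.
  rewrite powRrM /Z ge0_ler_powR ?divr_ge0 ?(ltW a0) ?(ltW b0)// ?nnegrE ?(ltW Eb0)//.
  exact: le_trans (ltW Eb0) EP.
have den : 0 < chi + K * Z by rewrite ltr_pwDl// mulr_ge0// powR_ge0.
have P'le : P' <= E `^ b * (chi + K * Z).
  have := ler_wpM2l K0 EaZ; rewrite -(ler_pM2l Eb0) => KEZ.
  have := powR_split2 ab E0 => EE.
  have : E `^ b * (K * E `^ a) = K * E ^+ 2 by rewrite -EE; ring.
  by rewrite /P' mulrDr; lra.
have E2 : rho `^ a * E `^ b <= E ^+ 2 / D `^ a.
  rewrite ler_pdivlMr// mulrAC -(powR_split2 ab E0) ler_pM2r//.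
  by rewrite -powRM ?(ltW r0) ?(ltW D0)// ge0_ler_powR ?nnegrE ?(ltW rD0) ?(ltW E0) ?(ltW a0).
rewrite mulrDl mul1r -lerBrDl; apply: le_trans dec.
have -> : C * rho `^ a / (chi + K * Z) * P' = C * (rho `^ a * (P' / (chi + K * Z))).
  by field; rewrite gt_eqF.
rewrite ler_pM2l//; apply: le_trans E2.
by rewrite ler_pM2l// ler_pdivrMr.
Qed.

End PotentialArithmetic.

(** * What an accepted outer step guarantees *)

Section OuterStep.
Context {R : realType} {n : nat}.
Implicit Types (X : set 'cV[R]_n) (f : 'cV[R]_n -> R) (st : state R n).

Lemma inner_returns_spec var X h H (x y : 'cV[R]_n) (eta : R) a b :
  convex_set X -> 0 <= eta ->
  X x -> (var = AFW -> active_spec X a x) ->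
  inner_returns X h H x eta var a y b ->
  [/\ X y, var = AFW -> active_spec X b y &
      forall v, X v -> dotp (model_grad h H x y) (y - v) <= eta].
Proof.
move=> cX eta0 Xx; case: var => [_ [run _]|/(_ erefl) ax run].
  by have [Xy gap] := fw_run_returns _ _ _ _ _ _ _ cX eta0 run Xx; split.
have [b_y gap] := afw_run_returns _ _ _ _ _ _ _ _ _ cX eta0 run ax.
by split=> //; exact: active_spec_mem b_y.
Qed.

(* [Delta] is only positive before termination: at the first iterate it is the
   dual norm of the gradient, which a nonzero Frank-Wolfe gap makes nonzero. *)
Definition state_ok var X f rho st :=
  [/\ X (st_x st), var = AFW -> active_spec X (st_act st) (st_x st),
      0 < st_theta st, 0 <= st_Delta st &
      fw_gap f X (st_x st) != 0 -> 0 < Delta f rho st].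

Lemma initial_state_ok var X f rho (theta0 : R) x : X !=set0 ->
  (forall x, X x -> posdef (hess f x)) -> 0 < theta0 ->
  initial_point var X x -> state_ok var X f rho (initial_state theta0 x).
Proof.
move=> [v0 Xv0] fp theta0_gt0 init.
have Xx : X x by move: init; case: var => //= -[[]].
split=> //= [_|gap].
  exists [:: x]; rewrite !big_seq1 /= eqxx scale1r; split=> //.
  - by split=> // w; rewrite inE => /eqP->.
  - by move=> w; rewrite in_fset1 inE.
  - by split=> w; rewrite ?ler0n// inE => /negPf->.
rewrite /Delta /= addr0 lt_max dnorm_gt0//; first exact: fp.
apply: contraNneq gap => g0; rewrite /fw_gap g0.
rewrite (_ : [set _ | _ in _] = [set 0]) ?sup1//.
apply/seteqP; split=> [_ [v _ <-]|_ ->]; first by rewrite /= dotp0l.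
by exists v0 => //; rewrite dotp0l.
Qed.

(** Only the accepted trial matters. Its acceptance test and its inner stopping test are rewritten
    as inequalities in [s] and the new residual, and [theta <= B D ^ a] makes them independent of
    the backtracking index. *)
Lemma outer_step_spec var X f (q c B rho omega tau : R) st st' :
  convex_set X -> (forall x, X x -> posdef (hess f x)) ->
  0 < c -> 0 < B -> 0 < rho -> 0 < omega -> 1 < tau ->
  state_ok var X f rho st -> outer_step var X f q c B rho omega tau st st' ->
  let D := Delta f rho st in
  let r := grad f (st_x st') + st_s st' in
  [/\ state_ok var X f rho st', 0 < D, st_Delta st' = D,
      (c * dnorm (hess f (st_x st)) r ^+ 2 - omega * D ^+ 2)
        / (B * D `^ ((q - 2) / (q - 1)))
      <= dotp (grad f (st_x st')) (st_x st - st_x st') &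
      forall v, X v -> dotp (st_s st') (v - st_x st') <= omega * D ^+ 2].
Proof.
move=> cX fp c0 B0 r0 w0 tau1 [Xx ax th0 De0 Dgap] [/Dgap D0].
move=> [J [y [a [/(_ J (leqnn J)) ret _ acc defst']]]].
rewrite /=; set D := Delta f rho st in D0 *; set x := st_x st in Xx ax ret *.
set al := (q - 2) / (q - 1).
have tau0 : 0 < tau by rewrite (lt_trans ltr01).
have Da0 : 0 < D `^ al by rewrite powR_gt0.
have BD0 : 0 < B * D `^ al by rewrite mulr_gt0.
have wD0 : 0 < omega * D ^+ 2 by rewrite mulr_gt0 ?exprn_gt0.
have eta0 : 0 < tolerance f q B rho omega st.
  by rewrite /tolerance /theta_max -/D -/al divr_gt0 ?addr_gt0.
have [Xy ay gap] := inner_returns_spec _ _ _ _ _ _ _ _ _ cX (ltW eta0) Xx ax ret.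
set th := trial_theta f q B rho tau st J in acc defst'.
have th_gt0 : 0 < th.
  by rewrite /th /trial_theta lt_min /theta_max -/D -/al BD0 mulr_gt0 ?exprn_gt0.
have th_le : th <= B * D `^ al by rewrite /th /trial_theta ge_min lexx orbT.
set s := trial_s f q B rho tau st J (y J) in acc defst'.
have sE : s = - model_grad (grad f x)
    ((trial_alpha f q B rho tau st J)^-1 *: hess f x) x (y J).
  by rewrite /s /trial_s /model_grad opprD scalemxAl.
(* The denominator [1 + theta_max] dominates each summand: [theta_max] gives the bound for the
   descent estimate, 1 the bound for the optimality gap. *)
have eta_le : tolerance f q B rho omega st <= omega * D ^+ 2 / (B * D `^ al).
  by rewrite /tolerance /theta_max -/D -/al ler_pM2l// lef_pV2 ?posrE ?addr_gt0// lerDr.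
have eta_le1 : tolerance f q B rho omega st <= omega * D ^+ 2.
  by rewrite /tolerance /theta_max -/D -/al ler_pdivrMr ?addr_gt0// ler_peMr ?(ltW wD0)// lerDl ltW.
have sv v : X v -> dotp s (v - y J) <= tolerance f q B rho omega st.
  move=> /gap; rewrite sE; congr (_ <= _).
  by rewrite dotpNl -dotpNr opprB.
rewrite defst' /=; split=> //.
- split=> //=; first by rewrite divr_gt0.
    by rewrite ltW.
  (* From the second iterate on, positivity is inherited through [rho * D], whatever the gap. *)
  by move=> _; rewrite /Delta/= lt_max mulr_gt0 ?orbT.
- have eta_s := sv x Xx.
  have Hp := fp x Xx; set r := grad f (y J) + s in acc *.
  have al_gt0 : 0 < trial_alpha f q B rho tau st J.
    by rewrite invr_gt0 addr_gt0.
  have wE : grad f x + s =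
      - ((trial_alpha f q B rho tau st J)^-1 *: (hess f x *m (y J - x))).
    by rewrite /s /trial_s addrA subrr add0r.
  (* Applying the inverse Hessian to [w] leaves [(x - y J) / alpha], and [alpha] cancels from the
     acceptance test. *)
  have decr : c / th * dnorm (hess f x) r ^+ 2 <= dotp r (x - y J).
    move: acc; rewrite /trial_accepted -/s -/th -/x -/r wE.
    rewrite mulmxN -scalemxAr mulKmx ?posdef_unit// -scalerN opprB dotpZr.
    rewrite ler_pdivlMl//; apply: le_trans.
    by rewrite le_eqVlt; apply/orP; left; apply/eqP; field; rewrite !gt_eqF.
  have th_inv : (B * D `^ al)^-1 <= th^-1 by rewrite lef_pV2 ?posrE.
  have cd0 : 0 <= c * dnorm (hess f x) r ^+ 2 by rewrite mulr_ge0 ?sqr_ge0 ?ltW.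
  have := ler_wpM2l cd0 th_inv; rewrite mulrBl.
  have -> : dotp (grad f (y J)) (x - y J) = dotp r (x - y J) - dotp s (x - y J).
    by rewrite /r dotpDl addrK.
  move: decr; rewrite mulrAC; lra.
- by move=> v /sv/le_trans; apply.
Qed.

End OuterStep.

(** * Contraction of the potential in one outer step *)

Section PotentialStep.
Context {R : realType} {n : nat}.
Implicit Types (X : set 'cV[R]_n) (f : 'cV[R]_n -> R) (st : state R n).

(** Strong convexity at [x] with gradient [r - s]; completing the square in [r + mu d] removes [d],
    and [L] turns the Euclidean norm of [r] into the dual norm. *)
Lemma optimality_gap_le X f (mu L T : R) x xstar (s : 'cV[R]_n) :
  twice_differentiable f -> convex_set X -> posdef (hess f x) ->
  0 < mu -> 0 < L -> hessian_bounds f X mu L -> X x -> X xstar ->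
  dotp s (xstar - x) <= T ->
  f x - f xstar <= L / (2 * mu) * dnorm (hess f x) (grad f x + s) ^+ 2 + T.
Proof.
move=> f2 cX Hp mu0 L0 bnd Xx Xs sT; set r := grad f x + s.
have sc := strong_convexity f X mu x xstar f2 cX (fun z Xz => (bnd z Xz).1) Xx Xs.
set d := xstar - x in sc sT.
have rd : dotp (grad f x) d = dotp r d - dotp s d by rewrite /r dotpDl addrK.
clearbody r d.
have rL : dotp r r <= L * dnorm (hess f x) r ^+ 2.
  by rewrite dnorm_sq//; exact: dual_ge L0 Hp (bnd x Xx).2 r.
have : 0 <= (2 * mu)^-1 * dotp (r + mu *: d) (r + mu *: d).
  by rewrite mulr_ge0 ?dotp_ge0// invr_ge0 mulr_ge0// ltW.
have -> : (2 * mu)^-1 * dotp (r + mu *: d) (r + mu *: d)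
   = (2 * mu)^-1 * dotp r r + dotp r d + mu / 2 * dotp d d.
  by rewrite !dotp_lin (dotpC d r); field; rewrite gt_eqF.
have : (2 * mu)^-1 * dotp r r <= L / (2 * mu) * dnorm (hess f x) r ^+ 2.
  by rewrite mulrAC mulrC ler_pM2r// invr_gt0 mulr_gt0.
lra.
Qed.

(** Both dual norms are compared with the Euclidean one, which produces the ratio [mu / L]. *)
Lemma dnorm_change_point X f (mu L : R) x y h :
  (forall x, X x -> posdef (hess f x)) -> 0 < L ->
  hessian_bounds f X mu L -> X x -> X y ->
  mu / L * dnorm (hess f y) h ^+ 2 <= dnorm (hess f x) h ^+ 2.
Proof.
move=> fp L0 bnd Xx Xy; rewrite mulrAC ler_pdivrMr// [leRHS]mulrC.
apply: (@le_trans _ _ (dotp h h)).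
  rewrite dnorm_sq; last exact: fp.
  exact: dual_le (fp y Xy) (bnd y Xy).1 h.
rewrite dnorm_sq; last exact: fp.
exact: dual_ge L0 (fp x Xx) (bnd x Xx).2 h.
Qed.

Lemma potential_step var X f xstar (q c B rho omega tau mu L chi P0 : R) st st' :
  twice_differentiable f -> convex_set X -> (forall x, X x -> posdef (hess f x)) ->
  is_argmin X f xstar -> 2 < q -> 0 < c -> 0 < B -> 0 < rho -> 0 < omega ->
  1 < tau -> 0 < mu -> 0 < L -> hessian_bounds f X mu L -> 0 < chi ->
  let a := (q - 2) / (q - 1) in
  let b := q / (q - 1) in
  let C := Num.min (c * mu / L / B - omega / (B * rho ^+ 2) - chi * rho `^ (- a))
        ((chi * (1 - rho `^ b) - omega / B) / rho ^+ 2) in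
  let Phi st := f (st_x st) - f xstar + chi * Delta f rho st `^ b in
  0 < C -> state_ok var X f rho st -> outer_step var X f q c B rho omega tau st st' ->
  Phi st <= P0 ->
  (1 + C * rho `^ a
     / (chi + (L / (2 * mu) + omega * rho ^- 2) * (P0 / chi) `^ ((q - 2) / q)))
    * Phi st' <= Phi st.
Proof.
move=> f2 cX fp [Xs xs_min] q2 c0 B0 r0 w0 tau1 mu0 L0 bnd chi0 a b C Phi C0 ok step PP0.
have [ok' D0 De dec sv] := outer_step_spec _ _ _ _ _ _ _ _ _ _ _ cX fp c0 B0 r0 w0 tau1 ok step.
have Xx : X (st_x st) by case: ok.
have Xx' : X (st_x st') by case: ok'.
set D := Delta f rho st in D0 De dec sv.
set r := grad f (st_x st') + st_s st' in dec.
set M := dnorm (hess f (st_x st)) r ^+ 2 in dec.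
pose N := dnorm (hess f (st_x st')) r.
have E_def : Delta f rho st' = Num.max N (rho * D) by rewrite /Delta De.
set E := Delta f rho st' in E_def.
have [a0 b0 ab] : [/\ 0 < a, 0 < b & a + b = 2] := exponents_spec q2.
have Eab : (q - 2) / q = a / b by rewrite /a /b; field; rewrite !gt_eqF//; lra.
have N0 : 0 <= N by exact: sqrtr_ge0.
(* Acceptance measures the residual at the old point, Delta at the new one. *)
have NM : c * mu / L * N ^+ 2 <= c * M.
  have : mu / L * N ^+ 2 <= M := dnorm_change_point _ _ _ _ _ _ r fp L0 bnd Xx Xx'.
  by rewrite -(ler_pM2l c0) !mulrA.
have gap : f (st_x st') - f xstar <= L / (2 * mu) * N ^+ 2 + omega * D ^+ 2 :=
  optimality_gap_le X f mu L _ _ _ _ f2 cX (fp _ Xx') mu0 L0 bnd Xx' Xs (sv _ Xs).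
clearbody N M.
have NE : N <= E by rewrite E_def le_max lexx.
have DE : rho * D <= E by rewrite E_def le_max lexx orbT.
have rD0 : 0 < rho * D by rewrite mulr_gt0.
have E0 : 0 < E by exact: lt_le_trans DE.
have NE2 : N ^+ 2 <= E ^+ 2 by rewrite lerXn2r ?nnegrE// ltW.
(* From [rho D <= E]: the inner error is paid by the new Delta, at the cost of [rho ^- 2]. *)
have DE2 : omega * D ^+ 2 <= omega * rho ^- 2 * E ^+ 2.
  rewrite -mulrA ler_pM2l// ler_pdivlMl ?exprn_gt0// -exprMn.
  by rewrite lerXn2r ?nnegrE ?(ltW rD0) ?(ltW E0).
(* Convexity at the new point bounds the decrease of [f] below by the inner product of
   [outer_step_spec]; the quadratic term is dropped. *)
have fdec : (c * mu / L * N ^+ 2 - omega * D ^+ 2) / (B * D `^ a) <=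
    (f (st_x st) - f xstar) - (f (st_x st') - f xstar).
  have sc := strong_convexity f X mu _ _ f2 cX (fun z Xz => (bnd z Xz).1) Xx' Xx.
  have dd : 0 <= mu / 2 * dotp (st_x st - st_x st') (st_x st - st_x st').
    by rewrite mulr_ge0 ?dotp_ge0// divr_ge0// ltW.
  apply: (@le_trans _ _ (dotp (grad f (st_x st')) (st_x st - st_x st'))); last by lra.
  refine (le_trans _ dec).
  by rewrite -/a ler_pM2r ?invr_gt0 ?mulr_gt0 ?powR_gt0// lerD2r.
have K0 : 0 <= L / (2 * mu) + omega * rho ^- 2.
  by rewrite addr_ge0// ?divr_ge0 ?mulr_ge0 ?exprn_ge0// ltW.
have F0 : 0 <= f (st_x st') - f xstar by rewrite subr_ge0 xs_min.
have FE : f (st_x st') - f xstar <= (L / (2 * mu) + omega * rho ^- 2) * E ^+ 2.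
  have : L / (2 * mu) * N ^+ 2 <= L / (2 * mu) * E ^+ 2.
    by rewrite ler_pM2l// divr_gt0// mulr_gt0.
  lra.
have FF : 0 <= f (st_x st') - f xstar <= (L / (2 * mu) + omega * rho ^- 2) * E ^+ 2.
  by rewrite F0 FE.
have g0 : 0 <= c * mu / L by rewrite divr_ge0 ?mulr_ge0 ?ltW.
have desc := potential_decrease ab a0 b0 r0 B0 g0 (ltW w0) chi0 D0 N0 E_def fdec.
rewrite Eab.
exact: (potential_contraction ab a0 b0 r0 K0 chi0 C0 D0 DE FF desc PP0).
Qed.

End PotentialStep.

(** * Geometric decay along a run *)

Theorem theorem3p6 (R : realType) (n : nat) (X : set 'cV[R]_n)
    (f : 'cV[R]_n -> R) (xstar : 'cV[R]_n) (p : nat) (nu Lp : R)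
    (X_nonempty : X !=set0) (X_compact : compact X) (X_convex : convex_set X)
    (f_convex : convex_function setT f)
    (f_twice_diff : twice_differentiable f)
    (f_posdef : forall x, X x -> posdef (hess f x))
    (xstar_min : is_argmin X f xstar)
    (p_2_3 : p = 2%N \/ p = 3%N) (nu_01 : 0 <= nu <= 1)
    (q_gt2 : 2 < p%:R + nu) (Lp_gt0 : 0 < Lp)
    (f_holder : holder_condition p f X nu Lp) :
  let q := p%:R + nu in
  let c := cst_c p : R in
  (exists mu L : R, [/\ 0 < mu, 0 < L & hessian_bounds f X mu L]) /\
  forall (mu L : R), 0 < mu -> 0 < L -> hessian_bounds f X mu L ->
  forall (rho omega : R), 0 < rho < 1 ->
  0 < omega < c * mu / L * rho ^+ 2 * (1 - rho `^ (q / (q - 1))) ->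
  let B := cst_B q Lp rho omega in
  let chi_min := omega / (B * (1 - rho `^ (q / (q - 1)))) in
  let chi_max :=
    rho `^ ((q - 2) / (q - 1)) / B * (c * mu / L - omega / rho ^+ 2) in
  chi_min < chi_max /\
  forall (chi : R), chi_min < chi < chi_max ->
  let c_chi :=
    Num.min
      (c * mu / (B * L) - omega / (B * rho ^+ 2)
         - chi * rho `^ (- ((q - 2) / (q - 1))))
      ((chi * (1 - rho `^ (q / (q - 1))) - omega / B) / rho ^+ 2) in
  0 < c_chi /\
  forall (var : variant) (tau theta0 : R), 1 < tau -> 0 < theta0 ->
  forall (st : nat -> state R n) (k : nat),
  generated var X f q c B rho omega tau theta0 st k ->
  let Phi i :=
    f (st_x (st i)) - f xstar + chi * Delta f rho (st i) `^ (q / (q - 1)) in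
  f (st_x (st k)) - f xstar <= Phi k /\
  Phi k <=
    (1 + c_chi * rho `^ ((q - 2) / (q - 1)) /
         (chi + (L / (2 * mu) + omega * rho ^- 2)
                * (Phi 0%N / chi) `^ ((q - 2) / q))) ^- k * Phi 0%N.
Proof.
move=> q c; split.
  exact: hessian_bounds_exist X_compact f_twice_diff f_posdef q_gt2 Lp_gt0 f_holder.
move=> mu L mu0 L0 bnd rho omega rho01 omega_bnd B chi_min chi_max.
have q2 : 2 < q by [].
have c0 : 0 < c by rewrite /c /cst_c; case: ifP => _; rewrite invr_gt0.
have /andP[r0 r1] := rho01; have /andP[w0 _] := omega_bnd.
have B0 : 0 < B.
  have kappa0 : 0 < cst_kappa rho omega by rewrite divr_gt0 ?ltr_pwDl ?sqrtr_ge0.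
  by rewrite /B /cst_B mulr_gt0 ?powR_gt0 ?mulr_gt0.
have [a0 b0 ab] := exponents_spec q2.
split; first exact: chi_interval ab b0 rho01 B0 omega_bnd.
move=> chi chi_bnd c_chi.
have g_div : c * mu / (B * L) = c * mu / L / B by rewrite invfM mulrA mulrAC.
have C0 : 0 < c_chi.
  by rewrite /c_chi g_div; exact: descent_constant_gt0 ab b0 rho01 B0 chi_bnd.
split=> // var tau theta0 tau1 theta0_gt0 st k [[x0 init st0] steps] Phi.
have chi0 : 0 < chi.
  apply: le_lt_trans (andP chi_bnd).1.
  rewrite divr_ge0 ?(ltW w0)// mulr_ge0 ?(ltW B0)//.
  exact/ltW/one_sub_powR_gt0.
have gap_le_Phi i : f (st_x (st i)) - f xstar <= Phi i.
  by rewrite lerDl mulr_ge0 ?powR_ge0// ltW.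
split; first exact: gap_le_Phi.
set d := c_chi * _ / _.
have Phi0 : 0 <= Phi 0%N.
  apply: le_trans (gap_le_Phi _); rewrite subr_ge0; apply: xstar_min.2.
  by rewrite st0; case: (initial_state_ok var X f rho _ _ X_nonempty f_posdef theta0_gt0 init).
have d0 : 0 <= d.
  rewrite divr_ge0// ?mulr_ge0 ?powR_ge0 ?(ltW C0)//.
  rewrite addr_ge0 ?(ltW chi0)// mulr_ge0 ?powR_ge0//.
  by rewrite addr_ge0// ?divr_ge0 ?mulr_ge0 ?invr_ge0 ?exprn_ge0// ltW.
(* The bound [Phi i <= Phi 0] joins the invariant since [d] is calibrated on [Phi 0], and [state_ok]
   makes the next step analysable. *)
suff: forall i, (i <= k)%N -> [/\ state_ok var X f rho (st i), Phi i <= Phi 0%N &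
    Phi i <= (1 + d) ^- i * Phi 0%N].
  by move=> /(_ k (leqnn k)) [].
elim=> [_|i IH ik].
  rewrite expr0 invr1 mul1r; split=> //; rewrite st0.
  exact: initial_state_ok.
have [ok P0 Pi] := IH (ltnW ik).
have step := steps i ik.
have ok' : state_ok var X f rho (st i.+1).
  by case: (outer_step_spec _ _ _ _ _ _ _ _ _ _ _ X_convex f_posdef c0 B0 r0 w0 tau1 ok step).
have contr : (1 + d) * Phi i.+1 <= Phi i.
  have := potential_step _ X f xstar q c B rho omega tau mu L chi _ _ _
    f_twice_diff X_convex f_posdef xstar_min q2 c0 B0 r0 w0 tau1 mu0 L0 bnd chi0 _ ok step P0.
  by rewrite -g_div => /(_ C0).
have P1 : 0 <= Phi i.+1.
  apply: le_trans (gap_le_Phi _); rewrite subr_ge0; apply: xstar_min.2.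
  by case: ok'.
have [le0 le1] := contraction_iter d0 P1 contr P0 Pi.
by split; [exact: ok'|exact: le0|exact: le1].
Qed.
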